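(* Let $(M,g)$ be a Riemannian manifold of dimension $m\ge2$, let $s>0$ and $d\in\mathbb{C}$. Let $\mathcal{F}$ be a family of smooth homogeneous degree $d$ maps from the cone $C_s(M)$ to $\mathbb{C}$. Then $\mathcal{F}$ is a $(0,0)$-eigenfamily on $C_s(M)$ if and only if the family of restrictions $\mathcal{F}|_{\{1\}\times M}$ is a $\left(-\frac{d(m+d-1)}{s},-\frac{d^2}{s}\right)$-eigenfamily on $(M,g)$.
   Context: The cone of slope $1/s$ over $M$ is $C_s(M)=(\mathbb{R}_{>0}\times M,\ s\,dt^2+t^2g)$, with $t$ the coordinate on $\mathbb{R}_{>0}$. A map $F:C_s(M)\to\mathbb{C}$ is homogeneous of degree $d$ if $F(t,x)=t^dF(1,x)$ for all $t>0$, $x\in M$; $\{1\}\times M$ is identified with $M$. On any Riemannian manifold, $\Delta=\operatorname{div}\nabla$ is the Laplace-Beltrami operator, extended complex-linearly, and $\kappa(\varphi,\psi)$ is the complex bilinear extension of the metric applied to $\nabla\varphi,\nabla\psi$. For $\lambda,\mu\in\mathbb{C}$, a set of smooth complex-valued functions is a $(\lambda,\mu)$-eigenfamily if $\Delta\varphi=\lambda\varphi$ and $\kappa(\varphi,\psi)=\mu\varphi\psi$ for all (not necessarily distinct) members $\varphi,\psi$. *)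

(* Defs.v *)
From HB Require Import structures.
From mathcomp Require Import all_boot all_order all_algebra.
From mathcomp Require Import complex.
From mathcomp Require Import all_classical all_reals all_analysis.

Set Implicit Arguments.
Unset Strict Implicit.
Unset Printing Implicit Defensive.

Import Order.TTheory GRing.Theory Num.Theory.
Import numFieldNormedType.Exports.

Local Open Scope classical_set_scope.
Local Open Scope ring_scope.
Local Open Scope complex_scope.

Section Smooth.
Context {R : realType} {n : nat}.
Implicit Types (U : set 'rV[R]_n) (f : 'rV[R]_n -> R).

Definition partial (i : 'I_n) f : 'rV[R]_n -> R := fun y => 'D_(delta_mx 0 i) f y.

(* Only used for open U, where this is the usual class C^k. *)
Fixpoint Ck (k : nat) U f : Prop :=
  if k is k'.+1 then
    (forall y, U y -> differentiable f y) /\ (forall i, Ck k' U (partial i f))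
  else forall y, U y -> {for y, continuous f}.

Definition smooth_on U f := forall k, Ck k U f.

End Smooth.

(* Raw data of a Riemannian manifold: a topological space, an atlas indexed by
   [chart], and the matrix (g_ij) of the metric in each chart, as a function of
   the chart coordinates. [chart_map a] and [chart_inv a] are total functions,
   meaningful on [chart_dom a] and on its image only; likewise [gmatrix a].
   The axioms are in [riemannian_manifold] below. *)
Record charted_metric (R : realType) (m : nat) := ChartedMetric {
  carrier :> topologicalType;
  chart : Type;
  chart_dom : chart -> set carrier;
  chart_map : chart -> carrier -> 'rV[R]_m;
  chart_inv : chart -> 'rV[R]_m -> carrier;
  gmatrix : chart -> 'rV[R]_m -> 'M[R]_m }.

Section Riemannian.
Context {R : realType} {m : nat}.
Variable M : charted_metric R m.
Implicit Types (a b : chart M) (p : M).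

Definition chart_im a : set 'rV[R]_m := chart_map a @` chart_dom a.
Definition transition a b : 'rV[R]_m -> 'rV[R]_m := fun y => chart_map b (chart_inv a y).

Record smooth_manifold : Prop := SmoothManifold {
  mfd_hausdorff : hausdorff_space M;
  mfd_second_countable : @second_countable M;
  dom_open : forall a, open (chart_dom a);
  im_open : forall a, open (chart_im a);
  dom_cover : forall p, exists a, chart_dom a p;
  chart_mapK : forall a p, chart_dom a p -> chart_inv a (chart_map a p) = p;
  chart_map_cont : forall a, {within chart_dom a, continuous (chart_map a)};
  chart_inv_cont : forall a, {within chart_im a, continuous (chart_inv a)};
  trans_smooth : forall a b (j : 'I_m),
    smooth_on (chart_map a @` (chart_dom a `&` chart_dom b)) (fun y => transition a b y 0 j) }.

Record riemannian_metric : Prop := RiemannianMetric {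
  gmatrix_smooth : forall a (i j : 'I_m), smooth_on (chart_im a) (fun y => gmatrix a y i j);
  gmatrix_sym : forall a y, chart_im a y -> (gmatrix a y)^T = gmatrix a y;
  gmatrix_pos : forall a y (v : 'rV[R]_m), chart_im a y -> v != 0 ->
    0 < (v *m gmatrix a y *m v^T) 0 0;
  (* Points are row vectors, so that 'D_v f y = v *m 'J f y: this says that
     the differential of the change of charts is isometric. *)
  gmatrix_trans : forall a b p, chart_dom a p -> chart_dom b p ->
    gmatrix a (chart_map a p) =
    let J := 'J (transition a b) (chart_map a p) in J *m gmatrix b (chart_map b p) *m J^T }.

Definition riemannian_manifold := smooth_manifold /\ riemannian_metric.

End Riemannian.

(* Vector fields, gradient and divergence are written in the coordinates of a
   chart a: (grad f)^i = sum_j g^ij d_j f and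
   div X = det(g)^(-1/2) sum_i d_i (det(g)^(1/2) X^i). *)
Section Operators.
Context {R : realType} {m : nat}.
Variable M : charted_metric R m.
Implicit Types (a : chart M) (p : M) (f h : M -> R) (phi psi : M -> R[i]).

Definition gradient a f : 'rV[R]_m -> 'rV[R]_m := fun y =>
  (\row_j partial j (f \o chart_inv a) y) *m invmx (gmatrix a y).

Definition vol_density a : 'rV[R]_m -> R := fun y => Num.sqrt (\det (gmatrix a y)).

Definition divergence a (X : 'rV[R]_m -> 'rV[R]_m) : 'rV[R]_m -> R := fun y =>
  (vol_density a y)^-1 * \sum_i partial i (fun z => vol_density a z * X z 0 i) y.

Definition inner a (X Y : 'rV[R]_m -> 'rV[R]_m) : 'rV[R]_m -> R := fun y =>
  (X y *m gmatrix a y *m (Y y)^T) 0 0.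

Definition laplacianR a f : 'rV[R]_m -> R := divergence a (gradient a f).

(* Complex-linear extension of the Laplace-Beltrami operator. *)
Definition laplacian a phi p : R[i] :=
  laplacianR a (fun q => complex.Re (phi q)) (chart_map a p)
  +i* laplacianR a (fun q => complex.Im (phi q)) (chart_map a p).

(* With phi = u + i v and psi = u' + i v', the complex bilinear extension of
   the metric evaluated at the gradients of phi and psi. *)
Definition kappa a phi psi p : R[i] :=
  let ip f h := inner a (gradient a f) (gradient a h) (chart_map a p) in
  let u q := complex.Re (phi q) in let v q := complex.Im (phi q) in
  let u' q := complex.Re (psi q) in let v' q := complex.Im (psi q) in
  (ip u u' - ip v v') +i* (ip u v' + ip v u').

Definition smooth_fun phi := forall a,
  smooth_on (chart_im a) (fun y => complex.Re (phi (chart_inv a y))) /\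
  smooth_on (chart_im a) (fun y => complex.Im (phi (chart_inv a y))).

(* The values of [laplacian a phi p] and [kappa a phi psi p] do not depend on the
   chart a around p; the equations are required in every chart. *)
Definition eigenfamily (lambda mu : R[i]) (F : set (M -> R[i])) :=
  [/\ forall phi, F phi -> smooth_fun phi,
      forall phi, F phi -> forall a p, chart_dom a p ->
        laplacian a phi p = lambda * phi p
    & forall phi psi, F phi -> F psi -> forall a p, chart_dom a p ->
        kappa a phi psi p = mu * phi p * psi p].

End Operators.

Definition posR (R : realType) : set R := [set t : R | 0 < t].
Arguments posR : clear implicits.

Lemma posR1 (R : realType) : (1 : R) \in posR R.
Proof. by rewrite inE /posR /= ltr01. Qed.

Definition one_pos (R : realType) : posR R := SigSub (posR1 R).
Arguments one_pos : clear implicits.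

(* R_{>0} x M with the product topology and the product charts (t, x); in these
   coordinates s dt^2 + t^2 g has a block diagonal matrix. The default value
   [one_pos R] only matters for t <= 0, outside of the image of the charts.
   See [cone_riemannian] for the proof that this is a Riemannian manifold. *)
Definition cone (R : realType) (m : nat) (M : charted_metric R m) (s : R) :
    charted_metric R (1 + m) :=
  @ChartedMetric R (1 + m) (posR R * M)%type (chart M)
    (fun a => [set p | chart_dom a p.2])
    (fun a p => row_mx (\val p.1)%:M (chart_map a p.2))
    (fun a y => (insubd (one_pos R) (lsubmx y 0 0), chart_inv a (rsubmx y)))
    (fun a y => block_mx s%:M 0 0 (lsubmx y 0 0 ^+ 2 *: gmatrix a (rsubmx y))).

(* t^d = exp (d ln t), for t > 0. *)
Definition cpow (R : realType) (t : R) (d : R[i]) : R[i] :=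
  (expR (complex.Re d * ln t))%:C *
  (cos (complex.Im d * ln t) +i* sin (complex.Im d * ln t)).

Definition homogeneous (R : realType) (m : nat) (M : charted_metric R m) (s : R)
    (d : R[i]) (phi : cone M s -> R[i]) :=
  forall (t : posR R) (x : M), phi (t, x) = cpow (\val t) d * phi (one_pos R, x).

Section SmoothTheory.
Context {R : realType}.
Lemma near_eq_differentiable {V W : normedModType R} (f g : V -> W) (x : V) :
  (\near x, f x = g x) -> differentiable f x -> differentiable g x.
Proof.
move=> fg df.
have gx : g x = f x by rewrite -(nbhs_singleton fg).
have /diff_locallyP[cdf ef] := df.
have eg : g \o shift x = cst (g x) + 'd f x +o_ 0 id.
  apply/eqaddoP => e e0; have /eqaddoP/(_ e e0) := ef.
  have fg0 : \forall h \near (0 : V), f (h + x) = g (h + x).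
    move: fg; rewrite (near_shift 0).
    by apply: filterS => h /=; rewrite subr0.
  apply: filter_app; apply: filterS fg0 => h fgh.
  by rewrite /= gx !fctE /= -fgh.
apply/diff_locallyP; have dg := diff_unique cdf eg.
by split; rewrite dg.
Qed.

Context {n : nat}.
Implicit Types (U : set 'rV[R]_n) (f g : 'rV[R]_n -> R).

Lemma open_near_eq U f g y : open U -> U y -> (forall z, U z -> f z = g z) ->
  \near y, f y = g y.
Proof. by move=> oU Uy fg; apply: filterS (open_nbhs_nbhs (conj oU Uy)). Qed.

Lemma eq_Ck k U f g : open U -> (forall y, U y -> f y = g y) ->
  Ck k U f -> Ck k U g.
Proof.
move=> oU; elim: k f g => [|k IH] f g fg /=.
  move=> cf y Uy; have := cf y Uy; rewrite /prop_for /continuous_at -(fg y Uy).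
  move=> cfy; apply: (cvg_trans _ cfy); apply: (@near_eq_cvg _ _ (nbhs y)).
  exact: (open_near_eq oU Uy fg).
move=> [df pf]; split.
  by move=> y Uy; apply: near_eq_differentiable (df y Uy); exact: (open_near_eq oU Uy).
move=> i; apply: IH (pf i) => y Uy; rewrite /partial.
by apply: near_eq_derive; exact: (open_near_eq oU Uy).
Qed.

Lemma Ck_cst k U (c : R) : Ck k U (fun=> c).
Proof.
elim: k c => [|k IH] c /=; first by move=> y _; exact: cst_continuous.
split=> [y _|i]; first exact: differentiable_cst.
suff -> : partial i (fun=> c) = fun=> 0 :> R by exact: IH.
by apply/funext => y; rewrite /partial derive_cst.
Qed.

Lemma CkS k U f : Ck k.+1 U f -> Ck k U f.
Proof.
elim: k f => [|k IH] f [df pf].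
  by move=> y Uy; exact/differentiable_continuous/df.
by split=> // i; apply: IH; exact: pf.
Qed.

Lemma CkD k U f g : open U -> Ck k U f -> Ck k U g -> Ck k U (fun y => f y + g y).
Proof.
move=> oU; elim: k f g => [|k IH] f g; first by
  move=> cf cg y Uy; exact: (cvgD (cf y Uy) (cg y Uy)).
move=> [df pf] [dg pg]; split=> [y Uy|i].
  by apply: differentiableD; [exact: df|exact: dg].
apply: eq_Ck (IH _ _ (pf i) (pg i)) => // y Uy.
by rewrite /partial deriveD//; apply: diff_derivable; [exact: df|exact: dg].
Qed.

Lemma CkM k U f g : open U -> Ck k U f -> Ck k U g -> Ck k U (fun y => f y * g y).
Proof.
move=> oU; elim: k f g => [|k IH] f g.
  by move=> cf cg y Uy; exact: (cvgM (cf y Uy) (cg y Uy)).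
move=> Cf Cg; have [[df pf] [dg pg]] := (Cf, Cg); split=> [y Uy|i].
  by apply: differentiableM; [exact: df|exact: dg].
have := CkD oU (IH _ _ (CkS Cf) (pg i)) (IH _ _ (CkS Cg) (pf i)).
apply: eq_Ck => // y Uy.
by rewrite /partial deriveM//; apply: diff_derivable; [exact: df|exact: dg].
Qed.

Lemma Ck_coord k U j : Ck k U (fun y => y 0 j).
Proof.
case: k => [|k]; first by move=> y _; exact: coord_continuous.
split=> [y _|i]; first exact: differentiable_coord.
suff -> : partial i (fun y => y 0 j) = fun=> (i == j)%:R :> R by exact: Ck_cst.
apply/funext => y; rewrite /partial deriveE; last exact: differentiable_coord.
have lin : linear (fun N : 'rV[R]_n => N 0 j : R) by move=> ???; rewrite !mxE.
pose F : {linear 'rV[R]_n -> R} := HB.pack (fun N : 'rV[R]_n => N 0 j : R)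
  (GRing.isLinear.Build _ _ _ _ _ lin).
rewrite (diff_lin (f := F)) /=; last exact: coord_continuous.
by rewrite mxE eqxx eq_sym.
Qed.

End SmoothTheory.

Lemma derive_rsubmx {R : realType} {n p : nat} (f : 'rV[R]_n -> R)
    (y v : 'rV[R]_(p + n)) :
  'D_v (fun y => f (rsubmx y)) y = 'D_(rsubmx v) f (rsubmx y).
Proof.
have E (h : R) : rsubmx (h *: v + y) = h *: rsubmx v + rsubmx y.
  by apply/rowP => l; rewrite !mxE.
have E' : (fun h : R => h^-1 *: (((fun y => f (rsubmx y)) \o shift y) (h *: v) - f (rsubmx y))) =
  (fun h => h^-1 *: ((f \o shift (rsubmx y)) (h *: rsubmx v) - f (rsubmx y))).
  by apply/funext => h /=; rewrite E.
by rewrite /derive E'.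
Qed.

Lemma partial_coord {R : realType} {n : nat} (i j : 'I_n) (y : 'rV[R]_n) :
  partial i (fun y => y 0 j) y = (i == j)%:R.
Proof.
rewrite /partial deriveE; last exact: differentiable_coord.
have lin : linear (fun N : 'rV[R]_n => N 0 j : R) by move=> ???; rewrite !mxE.
pose F : {linear 'rV[R]_n -> R} := HB.pack (fun N : 'rV[R]_n => N 0 j : R)
  (GRing.isLinear.Build _ _ _ _ _ lin).
rewrite (diff_lin (f := F)) /=; last exact: coord_continuous.
by rewrite mxE eqxx eq_sym.
Qed.

Lemma rsubmx_delta {R : realType} (p n : nat) (i : 'I_(p + n)) :
  rsubmx (delta_mx 0 i : 'rV[R]_(p + n)) =
  if fintype.split i is inr j then delta_mx 0 j else 0.
Proof.
apply/rowP => l; rewrite -[in LHS](splitK i); case: (fintype.split i) => j /=.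
  by rewrite !mxE /= eq_rlshift.
by rewrite !mxE /= eq_rshift.
Qed.

Lemma differentiable_row {R : realType} {V : normedModType R} {n : nat}
    (f : V -> 'rV[R]_n) (y : V) :
  (forall j, differentiable (fun z => f z 0 j) y) -> differentiable f y.
Proof.
move=> df; have -> : f = \sum_j (fun z => f z 0 j *: delta_mx 0 j : 'rV[R]_n).
  by apply/funext => z; rewrite fct_sumE; exact: row_sum_delta.
by apply: differentiable_sum => j; exact: differentiableZl.
Qed.

Lemma jacobian_partial {R : realType} {n p : nat} (f : 'rV[R]_n -> 'rV[R]_p)
    (y : 'rV[R]_n) i j :
  (forall j, differentiable (fun z => f z 0 j) y) ->
  'J f y i j = partial i (fun z => f z 0 j) y.
Proof.
move=> df; have dfy := differentiable_row df.
have -> : 'J f y i j = row i ('J f y) 0 j by rewrite [RHS]mxE.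
rewrite rowE.
rewrite -deriveEjacobian// derive_mx; last exact: diff_derivable.
by rewrite mxE.
Qed.

Lemma Ck_rsubmx {R : realType} {n : nat} k (p : nat) (U : set 'rV[R]_(p + n)) (V : set 'rV[R]_n)
    (f : 'rV[R]_n -> R) :
  open U -> (forall y, U y -> V (rsubmx y)) -> Ck k V f -> Ck k U (fun y => f (rsubmx y)).
Proof.
move=> oU UV; elim: k f => [|k IH] f.
  move=> cf y Uy; apply: continuous_comp; first exact: continuous_rsubmx.
  exact/cf/UV.
move=> [df pf]; split=> [y Uy|i].
  apply: differentiable_comp; first exact: differentiable_rsubmx.
  exact/df/UV.
rewrite /partial -(splitK i); case: (fintype.split i) => j /=.
  apply: (@eq_Ck _ _ _ _ (fun=> 0)) => //; last exact: Ck_cst.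
  move=> y Uy; rewrite derive_rsubmx; suff -> : rsubmx (delta_mx 0 (lshift n j)) = 0 :> 'rV[R]_n.
    by rewrite derive0.
  by apply/rowP => l; rewrite !mxE /= eq_rlshift.
apply: eq_Ck (IH _ (pf j)) => // y Uy; rewrite derive_rsubmx /partial.
congr ('D_ _ f _); apply/rowP => l; rewrite !mxE /=.
by rewrite eq_rshift.
Qed.

Lemma cluster_map {T S : topologicalType} (f : T -> S) p q : continuous f ->
  cluster (nbhs p) q -> cluster (nbhs (f p)) (f q).
Proof.
by move=> cf pq A B /cf pA /cf qB; have [z [Az Bz]] := pq _ _ pA qB; exists (f z).
Qed.

Lemma posR_val_continuous (R : realType) : continuous (\val : posR R -> R).
Proof. exact: initial_continuous. Qed.

Lemma posR_gt0 (R : realType) (t : posR R) : 0 < \val t.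
Proof. by have := valP t; rewrite /= inE. Qed.

Lemma insubd_posR (R : realType) (t0 : posR R) (t : R) : 0 < t ->
  \val (insubd t0 t) = t.
Proof. by move=> t1; rewrite insubdK// inE. Qed.

Lemma insubd_posRK (R : realType) (t0 t : posR R) : insubd t0 (\val t) = t.
Proof. exact: valKd. Qed.

Lemma cvg_posR (R : realType) {T : Type} (F : set_system T) {FF : Filter F}
    (f : T -> posR R) (t : posR R) :
  (fun x => \val (f x)) @ F --> \val t -> f @ F --> t.
Proof.
move=> cf A; rewrite nbhsE => -[B [[V oV VB] Bt] BA].
apply: filterS BA _; rewrite -VB; apply: (cf V).
by apply: open_nbhs_nbhs; split=> //; rewrite -VB in Bt.
Qed.

Section ConeRiemannian.
Context {R : realType} {m : nat}.
Variables (M : charted_metric R m) (s : R).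
Hypothesis s_gt0 : 0 < s.
Hypothesis hM : smooth_manifold M.
Hypothesis hg : riemannian_metric M.

Lemma cone_hausdorff : hausdorff_space (cone M s).
Proof.
move=> [t x] [u y] tu.
have xy : x = y.
  by apply: (mfd_hausdorff hM); apply: (cluster_map (f := snd) _ tu) => z; exact: cvg_snd.
have : \val t = \val u.
  apply: (@Rhausdorff R).
  apply: (cluster_map (f := fun p : posR R * M => \val p.1) _ tu) => z.
  by apply: continuous_comp; [exact: cvg_fst|exact: posR_val_continuous].
by move/val_inj => ->; rewrite xy.
Qed.

Lemma cone_second_countable : @second_countable (cone M s).
Proof.
have [B cB [oB bB]] := mfd_second_countable hM.
pose I (q : rat * rat) : set (posR R) := [set t | ratr q.1 < \val t < ratr q.2].
pose W (q : (rat * rat) * set M) : set (cone M s) := [set p | I q.1 p.1 /\ q.2 p.2].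
exists (W @` ([set: rat * rat] `*` B)).
  apply: (sub_countable (card_image_le _ _)).
  by apply: countableX => //; exact: countableP.
have oI q : open (I q).
  have -> : I q = \val @^-1` ([set` `]ratr q.1, ratr q.2[] : set R).
    by apply/seteqP; split=> t /=; rewrite in_itv.
  apply: open_comp; last exact: interval_open.
  by move=> t _; exact: posR_val_continuous.
split.
  move=> _ [[q V] [_ /= BV] <-].
  have -> : W (q, V) = (fst @^-1` I q) `&` (snd @^-1` V) by [].
  apply: openI; apply: open_comp => //; try exact: oB.
    by move=> z _; exact: cvg_fst.
  by move=> z _; exact: cvg_snd.
move=> [t x] A [[/= A1 A2] [nA1 nA2] sA].
have [V /= [BV Vx] VA] := bB x _ nA2.
have [C [[D oD DC] Ct] CA] := nA1.
have nD : nbhs (\val t : R) D.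
  by apply: open_nbhs_nbhs; split=> //; rewrite -DC in Ct.
have /nbhs_ballP[e /= e0 De] := nD.
have [p] := @rat_in_itvoo R (\val t - e) (\val t) ltac:(by rewrite ltrBlDr ltrDl).
have [q] := @rat_in_itvoo R (\val t) (\val t + e) ltac:(by rewrite ltrDl).
rewrite !in_itv /= => /andP[q1 q2] /andP[p1 p2].
exists (W ((p, q), V)).
  by split; [exists ((p, q), V)|split=> //; apply/andP].
move=> [u y] [/= /andP[pu uq] Vy]; apply: sA; split=> /=; last exact: VA.
apply: CA; rewrite -DC; apply: De; rewrite /ball /= distrC ltr_distl.
by rewrite (lt_trans p1 pu) (lt_trans uq q2).
Qed.

Lemma trans_dom_open (a b : chart M) : open (chart_map a @` (chart_dom a `&` chart_dom b)).
Proof.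
have -> : chart_map a @` (chart_dom a `&` chart_dom b) = chart_im a `&` (chart_inv a @^-1` chart_dom b).
  apply/seteqP; split=> [_ [x [ax bx] <-]|_ [[x ax <-]]].
    by split; [exists x|rewrite /= (chart_mapK hM)].
  by rewrite /= (chart_mapK hM)// => bx; exists x.
rewrite openE => y [iy by'].
have cy : {for y, continuous (chart_inv a)}.
  have := @chart_inv_cont _ _ _ hM a; rewrite continuous_open_subspace; last exact: im_open.
  by apply; rewrite inE.
apply: filterI; first by apply: open_nbhs_nbhs; split=> //; exact: im_open.
by apply: cy; apply: open_nbhs_nbhs; split=> //; exact: dom_open.
Qed.

Lemma cone_im (a : chart M) :
  chart_im (M := cone M s) a = [set y : 'rV[R]_(1 + m) | 0 < lsubmx y 0 0 /\ chart_im a (rsubmx y)].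
Proof.
apply/seteqP; split=> [_ [[t x] /= ax <-]|y [y0 [x ax xy]]] /=.
  rewrite row_mxKl row_mxKr mxE eqxx mulr1n; split; first exact: posR_gt0.
  by exists x.
exists (insubd (one_pos R) (lsubmx y 0 0), x) => //=.
by rewrite insubd_posR// xy -[RHS]hsubmxK; congr row_mx; apply/matrixP => i j; rewrite !ord1 !mxE.
Qed.


Lemma lsubmx_continuous : continuous (fun y : 'rV[R]_(1 + m) => lsubmx y 0 0 : R).
Proof.
have -> : (fun y : 'rV[R]_(1 + m) => lsubmx y 0 0 : R) = fun y => y 0 (lshift m 0).
  by apply/funext => y; rewrite mxE.
exact: coord_continuous.
Qed.

Lemma open_cone (U : set 'rV[R]_m) : open U ->
  open [set y : 'rV[R]_(1 + m) | 0 < lsubmx y 0 0 /\ U (rsubmx y)].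
Proof.
move=> oU; have -> : [set y : 'rV[R]_(1 + m) | 0 < lsubmx y 0 0 /\ U (rsubmx y)] =
  ((fun y : 'rV[R]_(1 + m) => lsubmx y 0 0 : R) @^-1` [set t | 0 < t]) `&` (rsubmx @^-1` U) by [].
apply: openI; apply: open_comp => //.
- by move=> y _; exact: lsubmx_continuous.
- by move=> y _; exact: continuous_rsubmx.
Qed.

Lemma cvg_matrix {T : Type} (F : set_system T) {FF : Filter F} (k l : nat)
    (f : T -> 'M[R]_(k, l)) (A : 'M[R]_(k, l)) :
  (forall i j, (fun x => f x i j) @ F --> A i j) -> f @ F --> A.
Proof.
move=> fA B [P nP PB].
have H : \forall x \near F, forall i j, P i j (f x i j).
  apply: filter_forall => i; apply: filter_forall => j; apply: fA; exact: nP.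
by apply: filterS H => x Px; exact: PB.
Qed.

Lemma row_mx_continuous (p : posR R * M) a : chart_dom a p.2 ->
  {for p, continuous (fun p : posR R * M => row_mx (\val p.1)%:M (chart_map a p.2) : 'rV[R]_(1 + m))}.
Proof.
move=> ap; apply: (@cvg_matrix _ (nbhs p)) => i j; rewrite -(splitK j).
case: (fintype.split j) => {}j /=.
  have E (q : posR R * M) :
      (row_mx (\val q.1)%:M (chart_map a q.2) : 'rV[R]_(1 + m)) i (lshift m j) = \val q.1.
    by rewrite row_mxEl !ord1 mxE eqxx mulr1n.
  rewrite E (_ : (fun q => _) = fun q : posR R * M => \val q.1); last exact/funext.
  by apply: (@continuous_comp _ _ _ fst (\val : posR R -> R) p);
    [exact: cvg_fst|exact: posR_val_continuous].
have E (q : posR R * M) :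
    (row_mx (\val q.1)%:M (chart_map a q.2) : 'rV[R]_(1 + m)) i (rshift 1 j) = chart_map a q.2 i j.
  by rewrite row_mxEr.
rewrite E (_ : (fun q => _) = fun q : posR R * M => chart_map a q.2 i j); last exact/funext.
have := @chart_map_cont _ _ _ hM a; rewrite continuous_open_subspace; last exact: dom_open.
move=> /(_ p.2); rewrite inE => /(_ ap) c2.
apply: (@continuous_comp _ _ _ snd (fun x => chart_map a x i j) p); first exact: cvg_snd.
by apply: (@continuous_comp _ _ _ (chart_map a) (fun v => v i j) p.2) => //; exact: coord_continuous.
Qed.

Lemma cone_smooth_manifold : smooth_manifold (cone M s).
Proof.
split.
- exact: cone_hausdorff.
- exact: cone_second_countable.
- move=> a; apply: (@open_comp _ _ snd) (dom_open hM a) => z _; exact: cvg_snd.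
- by move=> a; rewrite cone_im; apply: open_cone; exact: im_open.
- by move=> [t x]; have [a ax] := dom_cover hM x; exists a.
- move=> a [t x] /= ax; rewrite row_mxKl row_mxKr mxE eqxx mulr1n insubd_posRK.
  by rewrite (chart_mapK hM).
- move=> a; rewrite continuous_open_subspace; last first.
    by apply: (@open_comp _ _ snd) (dom_open hM a) => z _; exact: cvg_snd.
  by move=> p; rewrite inE => ap; exact: row_mx_continuous.
- move=> a; rewrite cone_im continuous_open_subspace; last first.
    by apply: open_cone; exact: im_open.
  move=> y; rewrite inE => -[y0 iy].
  have c1 : insubd (one_pos R) (lsubmx z 0 0) @[z --> y] -->
      (insubd (one_pos R) (lsubmx y 0 0) : posR R).
    apply: (@cvg_posR _ _ (nbhs y)); rewrite insubd_posR//.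
    apply: (cvg_trans _ (@lsubmx_continuous y)); apply: (@near_eq_cvg _ _ (nbhs y)).
    have := open_nbhs_nbhs (conj (open_cone openT) (conj y0 I)).
    by apply: filterS => z [z0 _]; rewrite insubd_posR.
  have c2 : @chart_inv _ _ M a (rsubmx z) @[z --> y] --> @chart_inv _ _ M a (rsubmx y).
    apply: continuous_comp; first exact: continuous_rsubmx.
    have := @chart_inv_cont _ _ _ hM a; rewrite continuous_open_subspace; last exact: im_open.
    by apply; rewrite inE.
  exact: (cvg_pair c1 c2).
- move=> a b.
  pose U := [set y : 'rV[R]_(1 + m) | 0 < lsubmx y 0 0 /\
    (@chart_map _ _ M a @` (@chart_dom _ _ M a `&` @chart_dom _ _ M b)) (rsubmx y)].
  have oU : open U by apply: open_cone; exact: trans_dom_open.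
  have -> : @chart_map _ _ (cone M s) a @` (@chart_dom _ _ (cone M s) a `&` @chart_dom _ _ (cone M s) b) = U.
    apply/seteqP; split=> [_ [[t x] /= abx <-]|y [y0 [x abx xy]]] /=.
      rewrite /U /= row_mxKl row_mxKr mxE eqxx mulr1n; split; first exact: posR_gt0.
      by exists x.
    exists (insubd (one_pos R) (lsubmx y 0 0), x) => //=.
    rewrite insubd_posR// xy -[RHS]hsubmxK; congr row_mx.
    by apply/matrixP => i j; rewrite !ord1 !mxE.
  move=> j k; rewrite -(splitK j); case: (fintype.split j) => {}j /=.
    apply: (eq_Ck oU _ (Ck_coord k U (lshift m j))) => y [y0 _].
    rewrite /transition /= row_mxEl ord1 mxE eqxx mulr1n insubd_posR//.
    by rewrite mxE.
  have := @trans_smooth _ _ _ hM a b j k.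
  move=> /(@Ck_rsubmx _ _ _ _ U _ _ oU) H.
  apply: eq_Ck (H _) => //.
    by move=> y _; rewrite /transition /= row_mxEr.
  by move=> y [].
Qed.


Lemma transition_differentiable a b (x : M) j : chart_dom a x -> chart_dom b x ->
  differentiable (fun y => transition a b y 0 j) (chart_map a x).
Proof.
move=> ax bx; have [d _] := @trans_smooth _ _ _ hM a b j 1%N.
by apply: d; exists x.
Qed.

Lemma cone_jacobian (a b : chart M) (t : posR R) (x : M) :
  chart_dom a x -> chart_dom b x ->
  'J (@transition _ _ (cone M s) a b) (@chart_map _ _ (cone M s) a (t, x)) =
  block_mx 1%:M 0 0 ('J (transition a b) (chart_map a x)).
Proof.
move=> ax bx; set y := @chart_map _ _ (cone M s) a (t, x).
have y1 : rsubmx y = chart_map a x by rewrite /y /= row_mxKr.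
have yt : lsubmx y 0 0 = \val t by rewrite /y /= row_mxKl mxE eqxx mulr1n.
have c0 (j : 'I_1) : \forall z \near y, ((z : 'rV[R]_(1 + m)) 0 (lshift m j) : R) =
    @transition _ _ (cone M s) a b z 0 (lshift m j).
  have y0 : 0 < lsubmx y 0 0 by rewrite yt posR_gt0.
  have := open_nbhs_nbhs (conj (open_cone openT) (conj y0 I)).
  apply: filterS => z [z0 _].
  by rewrite /transition /= row_mxEl ord1 mxE eqxx mulr1n insubd_posR// mxE.
have c1 (k : 'I_m) : (fun z => @transition _ _ (cone M s) a b z 0 (rshift 1 k)) =
    (fun z => @transition _ _ M a b (rsubmx z) 0 k).
  by apply/funext => z; rewrite /transition /= row_mxEr.
have dT (k : 'I_m) : differentiable (fun y => @transition _ _ M a b y 0 k) (rsubmx y).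
  by rewrite y1; exact: transition_differentiable.
have dF (j : 'I_(1 + m)) :
    differentiable (fun z => @transition _ _ (cone M s) a b z 0 j) y.
  rewrite -(splitK j); case: (fintype.split j) => k /=.
    by apply: (near_eq_differentiable (c0 k)); exact: differentiable_coord.
  rewrite c1.
  apply: (differentiable_comp (f := rsubmx) (g := fun u => @transition _ _ M a b u 0 k)).
    exact: differentiable_rsubmx.
  exact: dT.
apply/matrixP => i j; rewrite jacobian_partial//.
rewrite -(splitK j); case: (fintype.split j) => {}j /=.
  rewrite /partial -(near_eq_derive _ (c0 j)) -/(partial _ _ _) partial_coord.
  rewrite -(splitK i); case: (fintype.split i) => {}i /=.
    by rewrite block_mxEul mxE eq_lshift.
  by rewrite block_mxEdl mxE eq_rlshift.
rewrite c1 /partial (derive_rsubmx (fun u => @transition _ _ M a b u 0 j)).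
rewrite rsubmx_delta y1.
rewrite -[in RHS](splitK i); case: (fintype.split i) => {}i /=.
  by rewrite derive0 block_mxEur mxE.
rewrite block_mxEdr jacobian_partial//.
by move=> k; exact: transition_differentiable.
Qed.

Lemma cone_riemannian_metric : riemannian_metric (cone M s).
Proof.
have ltK (y : 'rV[R]_(1 + m)) : lsubmx y 0 0 = y 0 (lshift m 0) by rewrite mxE.
split.
- move=> a; rewrite cone_im => i j k.
  set U := [set y | _]; have oU : open U by apply: open_cone; exact: im_open.
  rewrite -(splitK i) -(splitK j).
  case: (fintype.split i) => {}i; case: (fintype.split j) => {}j /=.
  + by apply: (eq_Ck oU _ (Ck_cst k U (s *+ (i == j)))) => y _; rewrite block_mxEul mxE.
  + by apply: (eq_Ck oU _ (Ck_cst k U 0)) => y _; rewrite block_mxEur mxE.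
  + by apply: (eq_Ck oU _ (Ck_cst k U 0)) => y _; rewrite block_mxEdl mxE.
  have C0 := Ck_coord k U (lshift m 0 : 'I_(1 + m)).
  have C1 : Ck k U (fun y => @gmatrix _ _ M a (rsubmx y) i j).
    have H := @gmatrix_smooth _ _ _ hg a i j k.
    by apply: (Ck_rsubmx oU _ H) => y [].
  apply: eq_Ck (CkM oU (CkM oU C0 C0) C1) => // y _.
  by rewrite block_mxEdr [in RHS]mxE ltK expr2.
- move=> a y; rewrite cone_im => -[_ iy] /=.
  by rewrite tr_block_mx !trmx0 tr_scalar_mx linearZ /= (gmatrix_sym hg).
- move=> a y v; rewrite cone_im => -[y0 iy] v0 /=.
  set G := gmatrix _ _.
  have -> : (v *m block_mx s%:M 0 0 (lsubmx y 0 0 ^+ 2 *: G) *m v^T) 0 0 =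
      s * lsubmx v 0 0 ^+ 2 +
      lsubmx y 0 0 ^+ 2 * (rsubmx v *m G *m (rsubmx v)^T) 0 0.
    rewrite -{1 2}[v]hsubmxK mul_row_block tr_row_mx mul_row_col !mulmx0 addr0 add0r.
    rewrite mul_mx_scalar -scalemxAl -scalemxAr -scalemxAl.
    have E3 (A B : 'M[R]_1) : (A + B) 0 0 = A 0 0 + B 0 0 by rewrite mxE.
    have E4 (c : R) (A : 'M[R]_1) : (c *: A) 0 0 = c * A 0 0 by rewrite mxE.
    rewrite E3 !E4; congr (_ * _ + _).
    by rewrite [LHS]mxE big_ord1 [X in _ * X]mxE -expr2.
  have [r0|r0] := eqVneq (rsubmx v) 0; last first.
    apply: ltr_wpDl; first by rewrite mulr_ge0 ?sqr_ge0 ?(ltW s_gt0).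
    by apply: mulr_gt0; [exact: exprn_gt0|exact: (@gmatrix_pos _ _ _ hg a _ _ iy r0)].
  rewrite r0 !mul0mx (_ : (0 : 'M[R]_1) 0 0 = 0); last by rewrite mxE.
  rewrite mulr0 addr0.
  rewrite mulr_gt0// exprn_even_gt0//=; apply: contra_neq v0 => l0.
  rewrite -[v]hsubmxK r0 (_ : lsubmx v = 0) ?row_mx0//.
  by apply/matrixP => i j; rewrite !ord1 l0 mxE.
- move=> a b [t x] /= ax bx; rewrite (cone_jacobian t ax bx).
  rewrite !row_mxKr !row_mxKl !mxE eqxx mulr1n.
  rewrite tr_block_mx !trmx0 trmx1 !mulmx_block !mul0mx !mulmx0 !mul1mx !mulmx1.
  rewrite !(addr0, add0r, mul0mx).
  by rewrite (@gmatrix_trans _ _ _ hg a b _ ax bx) /= -scalemxAr -scalemxAl.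
Qed.

End ConeRiemannian.

Theorem cone_riemannian (R : realType) (m : nat) (M : charted_metric R m) (s : R) :
  0 < s -> riemannian_manifold M -> riemannian_manifold (cone M s).
Proof.
by move=> s0 [hM hg]; split; [exact: cone_smooth_manifold|exact: cone_riemannian_metric].
Qed.

(* Main.v *)
(* In a product chart (t, x) the cone metric is block diagonal, so that for
   f, h on the cone
     kappa(f, h) = d_t f d_t h / s + t^-2 kappa_M(f(t, .), h(t, .)),
     Delta f = (d_t^2 f + (m / t) d_t f) / s + t^-2 Delta_M f(t, .).
   If phi(t, x) = t^d phi_1(x) and psi(t, x) = t^d psi_1(x), this gives
     Delta phi = t^(d-2) (d (m + d - 1) / s phi_1 + Delta_M phi_1),
     kappa(phi, psi) = t^(2(d-1)) (d^2 / s phi_1 psi_1 + kappa_M(phi_1, psi_1)),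
   and the powers of t do not vanish. *)
Require Import Defs.
From HB Require Import structures.
From mathcomp Require Import all_boot all_order all_algebra.
From mathcomp Require Import complex ring.
From mathcomp Require Import all_classical all_reals all_analysis.
Import Order.TTheory GRing.Theory Num.Theory.
Import numFieldNormedType.Exports.
Local Open Scope classical_set_scope.
Local Open Scope ring_scope.
Local Open Scope complex_scope.

(** * Partial derivatives in the coordinates (t, x) of a product chart *)

Lemma partial_lshift {R : realType} {m : nat} (Phi : R -> 'rV[R]_m -> R)
    (y : 'rV[R]_(1 + m)) :
  partial (lshift m 0) (fun z => Phi (lsubmx z 0 0) (rsubmx z)) y =
  'D_1 (Phi ^~ (rsubmx y)) (lsubmx y 0 0).
Proof.
rewrite /partial /derive /=.
have E (h : R) : rsubmx (h *: delta_mx 0 (lshift m 0) + y) = rsubmx y.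
  by apply/rowP => j; rewrite !mxE eq_rlshift andbF mulr0 add0r.
have E' (h : R) : lsubmx (h *: delta_mx 0 (lshift m 0) + y) 0 0 = h%:A + lsubmx y 0 0.
  by rewrite !mxE !eqxx.
by under eq_fun do rewrite E E'.
Qed.

Lemma partial_rshift {R : realType} {m : nat} (Phi : R -> 'rV[R]_m -> R)
    (y : 'rV[R]_(1 + m)) (i : 'I_m) :
  partial (rshift 1 i) (fun z => Phi (lsubmx z 0 0) (rsubmx z)) y =
  partial i (Phi (lsubmx y 0 0)) (rsubmx y).
Proof.
rewrite /partial /derive /=.
have E (h : R) : rsubmx (h *: delta_mx 0 (rshift 1 i) + y) = h *: delta_mx 0 i + rsubmx y.
  by apply/rowP => j; rewrite !mxE eq_rshift.
have E' (h : R) : lsubmx (h *: delta_mx 0 (rshift 1 i) + y) 0 0 = lsubmx y 0 0.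
  by rewrite !mxE eq_lrshift andbF mulr0 add0r.
by under eq_fun do rewrite E E'.
Qed.

Lemma partial_lincomb {R : realType} {m : nat} (c1 c2 : R) (f1 f2 : 'rV[R]_m -> R)
    (x : 'rV[R]_m) (i : 'I_m) :
  differentiable f1 x -> differentiable f2 x ->
  partial i (fun z => c1 * f1 z + c2 * f2 z) x = c1 * partial i f1 x + c2 * partial i f2 x.
Proof.
move=> df1 df2.
have d1 : derivable f1 x (delta_mx 0 i) by exact: diff_derivable.
have d2 : derivable f2 x (delta_mx 0 i) by exact: diff_derivable.
rewrite /partial deriveD; last 2 first.
- exact: (derivableZ (f := f1)).
- exact: (derivableZ (f := f2)).
by rewrite (deriveZ (f := f1))// (deriveZ (f := f2)).
Qed.

(* Along the segment from A to the identity the determinant is a polynomial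
   without zeros, since positivity of the form is preserved. *)
Lemma det_pos_form {R : rcfType} {m : nat} (A : 'M[R]_m) :
  (forall v : 'rV_m, v != 0 -> 0 < (v *m A *m v^T) 0 0) -> 0 < \det A.
Proof.
move=> Apos.
pose P : 'M[{poly R}]_m := \matrix_(i, j) ((A i j)%:P * (1 - 'X) + (i == j)%:R * 'X).
have evP t : (\det P).[t] = \det ((1 - t) *: A + t%:M).
  rewrite -[LHS]/(horner_eval t (\det P)) -det_map_mx; congr (\det _).
  apply/matrixP => i j; rewrite !mxE /= /horner_eval !hornerE.
  by rewrite mulrC; case: eqP => _; rewrite ?mulr1n ?mulr0n !hornerE.
rewrite ltNge; apply/negP => det_le0.
have [||t /andP[t_ge0 t_le1] /rootP] := @poly_ivt _ (\det P) 0 1 => //.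
  by rewrite !evP subr0 scale1r raddf0 addr0 det_le0 subrr scale0r add0r det1 ler01.
(* At a root t some v != 0 is killed by (1 - t) A + t I; pairing with v contradicts positivity. *)
rewrite evP => /eqP /det0P[v v0].
rewrite mulmxDr mul_mx_scalar -scalemxAr => /(congr1 (fun w => (w *m v^T) 0 0)).
have lin (B C : 'M[R]_1) : ((1 - t) *: B + t *: C) 0 0 = (1 - t) * B 0 0 + t * C 0 0.
  by rewrite !mxE.
rewrite mulmxDl -!scalemxAl mul0mx lin [RHS]mxE.
apply/eqP; rewrite gt_eqF//.
have vv : 0 < (v *m v^T) 0 0.
  rewrite mxE; have [j vj] : exists j, v 0 j != 0.
    apply/existsP; apply: contra_neqT v0; rewrite negb_exists => /forallP v0.
    by apply/rowP => j; have := v0 j; rewrite negbK mxE => /eqP.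
  rewrite (bigD1 j)//= mxE -expr2 ltr_pwDl ?exprn_even_gt0//.
  by apply: sumr_ge0 => k _; rewrite mxE -expr2 sqr_ge0.
(* At t = 1 the strictly positive summand is the second one, for t < 1 it is the first. *)
have [->|t1] := eqVneq t 1; first by rewrite subrr mul0r add0r mul1r.
have t_lt1 : 0 < 1 - t by rewrite subr_gt0 lt_neqAle t1.
by rewrite ltr_pwDl ?mulr_gt0 ?mulr_ge0 ?(ltW vv)// Apos.
Qed.

(** * Differentiability of determinants and inverse matrices *)

Section DifferentiableMatrix.
Context {R : realType} {V : normedModType R}.

Lemma differentiable_bigsum (I : Type) (r : seq I) (P : pred I) (f : I -> V -> R) (x : V) :
  (forall i, differentiable (f i) x) -> differentiable (fun z => \sum_(i <- r | P i) f i z) x.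
Proof.
move=> df; elim: r => [|i r IH].
  by under eq_fun do rewrite big_nil; exact: differentiable_cst.
under eq_fun do rewrite big_cons.
by case: (P i) => //; apply: differentiableD.
Qed.

Lemma differentiable_bigprod (I : Type) (r : seq I) (P : pred I) (f : I -> V -> R) (x : V) :
  (forall i, differentiable (f i) x) -> differentiable (fun z => \prod_(i <- r | P i) f i z) x.
Proof.
move=> df; elim: r => [|i r IH].
  by under eq_fun do rewrite big_nil; exact: differentiable_cst.
under eq_fun do rewrite big_cons.
by case: (P i) => //; apply: differentiableM.
Qed.

Lemma differentiable_det n (A : V -> 'M[R]_n) (x : V) :
  (forall i j, differentiable (fun z => A z i j) x) -> differentiable (fun z => \det (A z)) x.
Proof.
move=> dA; apply: differentiable_bigsum => p.
apply: differentiableM; first exact: differentiable_cst.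
by apply: differentiable_bigprod => i; exact: dA.
Qed.

(** Near x the inverse is the adjugate divided by the determinant. Nonvanishing is asked on a
    neighbourhood because [invmx] returns its argument at singular matrices. *)
Lemma differentiable_invmx n (A : V -> 'M[R]_n) (x : V) :
  (forall i j, differentiable (fun z => A z i j) x) ->
  (\forall z \near x, \det (A z) != 0) ->
  forall i j, differentiable (fun z => invmx (A z) i j) x.
Proof.
move=> dA Ax i j.
apply: (near_eq_differentiable (f := fun z => (\det (A z))^-1 * cofactor (A z) j i)).
  by apply: filterS Ax => z Az; rewrite /invmx unitmxE unitfE Az !mxE.
apply: differentiableM.
  by apply: differentiableV; [exact: differentiable_det|exact: nbhs_singleton Ax].
apply: differentiableM; first exact: differentiable_cst.
by apply: differentiable_det => k l; under eq_fun do rewrite !mxE; exact: dA.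
Qed.

End DifferentiableMatrix.

(** * Differentiability of the metric data in a chart of M *)

Section ChartRegularity.
Context {R : realType} {m : nat} {M : charted_metric R m}.
Hypothesis hM : riemannian_manifold M.
Variable a : chart M.

Lemma det_gmatrix_gt0 {x} : chart_im a x -> 0 < \det (gmatrix a x).
Proof. by move=> ax; apply: det_pos_form => v v0; exact: (gmatrix_pos hM.2). Qed.

Lemma vol_density_gt0 {x} : chart_im a x -> 0 < vol_density a x.
Proof. by move=> ax; rewrite sqrtr_gt0 det_gmatrix_gt0. Qed.

Lemma differentiable_gmatrix x i j : chart_im a x ->
  differentiable (fun z => gmatrix a z i j) x.
Proof. by move=> ax; have [d _] := @gmatrix_smooth _ _ _ hM.2 a i j 1%N; exact: d. Qed.

(** Positivity of the determinant keeps the square root away from 0, where it is not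
    differentiable. *)
Lemma differentiable_vol_density x : chart_im a x -> differentiable (vol_density a) x.
Proof.
move=> ax; apply: (differentiable_comp (f := fun z => \det (gmatrix a z)) (g := @Num.sqrt R)).
  by apply: differentiable_det => i j; exact: differentiable_gmatrix.
by apply/derivable1_diffP; have [] := is_derive1_sqrt (det_gmatrix_gt0 ax).
Qed.

(** These are the products differentiated in [divergence]; the lemma lets a linear combination of
    two of them be differentiated termwise. *)
Lemma differentiable_vol_gradient (w : M -> R) x i :
  smooth_on (chart_im a) (fun y => w (chart_inv a y)) -> chart_im a x ->
  differentiable (fun z => vol_density a z * gradient a w z 0 i) x.
Proof.
move=> sw ax; apply: differentiableM; first exact: differentiable_vol_density.
under eq_fun do rewrite mxE.
apply: differentiable_bigsum => j; apply: differentiableM.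
  (* Order 2 is used here because the gradient already takes one derivative of [w]. *)
  by under eq_fun do rewrite mxE; have [_ /(_ j)[d _]] := sw 2%N; exact: d.
apply: differentiable_invmx => [k l|]; first exact: differentiable_gmatrix.
have := open_nbhs_nbhs (conj (im_open hM.1 (a := a)) ax).
by apply: filterS => z az; rewrite gt_eqF// det_gmatrix_gt0.
Qed.

End ChartRegularity.

(** * Restriction to slices, radial derivatives and bilinear expansions *)

(** The induction goes through because a partial derivative of the slice is the slice of the partial
    derivative in the shifted direction. *)
Lemma Ck_row_mx {R : realType} {n : nat} k (c : R) (U : set 'rV[R]_(1 + n)) (V : set 'rV[R]_n)
    (f : 'rV[R]_(1 + n) -> R) :
  (forall x, V x -> U (row_mx c%:M x)) -> Ck k U f -> Ck k V (fun x => f (row_mx c%:M x)).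
Proof.
move=> VU.
have dr x : differentiable (fun x : 'rV[R]_n => row_mx c%:M x : 'rV[R]_(1 + n)) x.
  apply: differentiable_row => j; rewrite -(splitK j); case: (fintype.split j) => {}j /=.
    by under eq_fun do rewrite row_mxEl; exact: differentiable_cst.
  by under eq_fun do rewrite row_mxEr; exact: differentiable_coord.
elim: k f => [|k IH] f /=.
  move=> cf x Vx; apply: continuous_comp; first exact: differentiable_continuous.
  exact/cf/VU.
move=> [df pf]; split=> [x Vx|i].
  by apply: differentiable_comp => //; exact/df/VU.
suff -> : partial i (fun x => f (row_mx c%:M x)) =
    fun x => partial (rshift 1 i) f (row_mx c%:M x) by exact: IH.
apply/funext => x; rewrite -{2}[f](_ : (fun z => f (row_mx (lsubmx z 0 0)%:M (rsubmx z))) = f).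
  rewrite (partial_rshift (fun t x => f (row_mx t%:M x))).
  by rewrite row_mxKl row_mxKr mxE eqxx.
apply/funext => z; rewrite -[in RHS](hsubmxK z); congr (f (row_mx _ _)).
by apply/matrixP => k' l; rewrite !ord1 mxE eqxx.
Qed.

Lemma sum_lincomb {R : comNzRingType} {I : finType} (c1 c2 : R) (f1 f2 : I -> R) :
  \sum_i (c1 * f1 i + c2 * f2 i) = c1 * \sum_i f1 i + c2 * \sum_i f2 i.
Proof. by rewrite big_split !mulr_sumr. Qed.

(** Writing n t^(n-1) as n t^n / t keeps one formula for all n, including 0. With n = m it yields
    the m / t term of the cone Laplacian. *)
Lemma derive_expM {R : realType} (c : R) n {t d : R} {h : R -> R} :
  is_derive t 1 h d -> t != 0 ->
  'D_1 (fun u : R => c * u ^+ n * h u) t = c * (t ^+ n * d + n%:R * t ^+ n / t * h t).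
Proof.
move=> D t0.
have -> : (fun u : R => c * u ^+ n * h u) = (c *: (@id R) ^+ n) * h.
  by apply/funext => u; rewrite !fctE.
rewrite derive_val (_ : (c *: (@id R) ^+ n) t = c * t ^+ n); last by rewrite !fctE.
have scaleE (u v : R) : u *: v = u * v by [].
by case: n => [|n]; rewrite !scaleE ?exprS /=; field.
Qed.

Lemma bilinear_form_lincomb {R : comNzRingType} {m : nat} (q r a1 a2 b1 b2 : R)
    (X1 X2 Y1 Y2 : 'rV[R]_m) (G : 'M[R]_m) :
  let ip X Y := (X *m G *m Y^T) 0 0 in
  ip (q *: (a1 *: X1 + a2 *: X2)) (r *: (b1 *: Y1 + b2 *: Y2)) =
  q * r * (a1 * (b1 * ip X1 Y1 + b2 * ip X1 Y2) + a2 * (b1 * ip X2 Y1 + b2 * ip X2 Y2)).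
Proof.
have linD (A B : 'M[R]_1) : (A + B) 0 0 = A 0 0 + B 0 0 by rewrite mxE.
have linZ (c : R) (A : 'M[R]_1) : (c *: A) 0 0 = c * A 0 0 by rewrite mxE.
have trD (A B : 'rV[R]_m) : (A + B)^T = A^T + B^T by rewrite linearD.
have trZ c (A : 'rV[R]_m) : (c *: A)^T = c *: A^T by rewrite linearZ.
have mulZl c p (A : 'rV[R]_m) (B : 'M[R]_(m, p)) : (c *: A) *m B = c *: (A *m B).
  by rewrite scalemxAl.
have mulZr c (A : 'rV[R]_m) (B : 'cV[R]_m) : A *m (c *: B) = c *: (A *m B) by rewrite scalemxAr.
move=> ip; rewrite /ip !(trD, trZ, mulmxDl, mulmxDr, mulZl, mulZr, linD, linZ); ring.
Qed.

Lemma is_derive_lincomb {R : realType} {h1 h2 : R -> R} {t d1 d2 : R} (c1 c2 : R) :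
  is_derive t 1 h1 d1 -> is_derive t 1 h2 d2 ->
  is_derive t 1 (fun t => h1 t * c1 + h2 t * c2) (d1 * c1 + d2 * c2).
Proof.
move=> D1 D2; have := is_deriveD (is_deriveZ c1 D1) (is_deriveZ c2 D2).
rewrite (_ : c1 *: h1 + c2 *: h2 = fun t => h1 t * c1 + h2 t * c2); last first.
  by apply/funext => u; rewrite mulrC (mulrC (h2 u)).
by rewrite mulrC (mulrC d2).
Qed.

(** * Gradient, metric pairing and Laplacian of real functions on the cone *)

Section ConeOperators.
Context {R : realType} {m : nat} {M : charted_metric R m} {s : R}.
Hypothesis hM : riemannian_manifold M.
Hypothesis hs : 0 < s.
Variable a : chart M.

(** By [cone_im] this is the image of the cone chart; there t > 0, so the default value in [insubd]
    is never reached. *)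
Definition cone_dom : set 'rV[R]_(1 + m) :=
  [set y | 0 < lsubmx y 0 0 /\ chart_im a (rsubmx y)].

Lemma near_cone_dom {y : 'rV[R]_(1 + m)} {f g : 'rV[R]_(1 + m) -> R} :
  cone_dom y -> (forall z, cone_dom z -> f z = g z) -> \near y, f y = g y.
Proof. by apply: open_near_eq; apply: open_cone; exact: (im_open hM.1 (a := a)). Qed.

(** A formula for [f] valid only for t > 0 suffices, since [cone_dom] is open and derivatives are
    local. *)
Lemma partial_cone_lshift {f : 'rV[R]_(1 + m) -> R} (Phi : R -> 'rV[R]_m -> R) y :
  cone_dom y -> (forall z, cone_dom z -> f z = Phi (lsubmx z 0 0) (rsubmx z)) ->
  partial (lshift m 0) f y = 'D_1 (Phi ^~ (rsubmx y)) (lsubmx y 0 0).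
Proof.
by move=> Uy fP; rewrite -partial_lshift /partial (near_eq_derive _ (near_cone_dom Uy fP)).
Qed.

Lemma partial_cone_rshift {f : 'rV[R]_(1 + m) -> R} (Phi : R -> 'rV[R]_m -> R) y i :
  cone_dom y -> (forall z, cone_dom z -> f z = Phi (lsubmx z 0 0) (rsubmx z)) ->
  partial (rshift 1 i) f y = partial i (Phi (lsubmx y 0 0)) (rsubmx y).
Proof.
by move=> Uy fP; rewrite -partial_rshift /partial (near_eq_derive _ (near_cone_dom Uy fP)).
Qed.

(** The determinant is s (t^2)^m det g, and the square root of (t^2)^m is t^m because t > 0. *)
Lemma vol_density_cone y : cone_dom y ->
  vol_density (M := cone M s) a y =
  Num.sqrt s * lsubmx y 0 0 ^+ m * vol_density a (rsubmx y).
Proof.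
move=> [t0 ax]; rewrite /vol_density /= det_ublock det_scalar1 detZ mulrA.
rewrite sqrtrM; last by rewrite mulr_ge0 ?(ltW hs)// exprn_ge0// sqr_ge0.
rewrite sqrtrM ?(ltW hs)// -exprM mulnC exprM sqrtr_sqr ger0_norm//.
by rewrite exprn_ge0// ltW.
Qed.

(** Two terms, because for complex d the real part of t^d w mixes the real and imaginary parts of w,
    each with its own radial factor. *)
Definition separated_sum (h1 h2 : R -> R) (w1 w2 : M -> R) (f : cone M s -> R) :=
  forall (t : posR R) x, f (t, x) = h1 (\val t) * w1 x + h2 (\val t) * w2 x.

Definition smooth_in_chart (w : M -> R) :=
  smooth_on (chart_im a) (fun x => w (chart_inv a x)).

(** The inverse metric is block diagonal, with blocks 1 / s and t^-2 g^-1 acting on the radial and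
    tangential derivatives. *)
Lemma gradient_cone {h1 h2 w1 w2 f y d1 d2} :
  separated_sum h1 h2 w1 w2 f -> smooth_in_chart w1 -> smooth_in_chart w2 ->
  cone_dom y ->
  is_derive (lsubmx y 0 0) 1 h1 d1 -> is_derive (lsubmx y 0 0) 1 h2 d2 ->
  gradient (M := cone M s) a f y =
  row_mx (s^-1 * (d1 * w1 (chart_inv a (rsubmx y)) + d2 * w2 (chart_inv a (rsubmx y))))%:M
    (lsubmx y 0 0 ^- 2 *: (h1 (lsubmx y 0 0) *: gradient a w1 (rsubmx y) +
                           h2 (lsubmx y 0 0) *: gradient a w2 (rsubmx y))).
Proof.
move=> hf s1 s2 Uy dh1 dh2; have [t0 ax] := Uy.
pose Phi t x := h1 t * w1 (chart_inv a x) + h2 t * w2 (chart_inv a x).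
have fP z : cone_dom z -> (f \o @chart_inv _ _ (cone M s) a) z = Phi (lsubmx z 0 0) (rsubmx z).
  by move=> [z0 _]; rewrite /= hf insubd_posR.
rewrite /gradient; set G := gmatrix a (rsubmx y).
have -> : \row_j partial j (f \o @chart_inv _ _ (cone M s) a) y =
    row_mx (d1 * w1 (chart_inv a (rsubmx y)) + d2 * w2 (chart_inv a (rsubmx y)))%:M
     (h1 (lsubmx y 0 0) *: (\row_j partial j (w1 \o chart_inv a) (rsubmx y)) +
      h2 (lsubmx y 0 0) *: (\row_j partial j (w2 \o chart_inv a) (rsubmx y))).
  apply/rowP => j; rewrite mxE -(splitK j); case: (fintype.split j) => {}j /=.
    rewrite row_mxEl !ord1 mxE eqxx mulr1n (partial_cone_lshift Phi y Uy fP).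
    by have [_ <-] := is_derive_lincomb (w1 (chart_inv a (rsubmx y))) (w2 (chart_inv a (rsubmx y))) dh1 dh2.
  rewrite row_mxEr (partial_cone_rshift Phi y j Uy fP) !mxE.
  have [d1' _] := s1 1%N; have [d2' _] := s2 1%N.
  by rewrite partial_lincomb //; [exact: d1'|exact: d2'].
rewrite /= -/G invmx_block_diag; last first.
  rewrite unitmxE det_ublock det_scalar1 detZ unitfE mulf_neq0 ?gt_eqF//.
  by rewrite mulr_gt0 ?exprn_gt0// det_gmatrix_gt0.
rewrite mul_row_block !mulmx0 addr0 add0r invmx_scalar -scalar_mxM mulrC.
rewrite invmxZ; last by rewrite unitmxE detZ unitfE gt_eqF// mulr_gt0 ?exprn_gt0// det_gmatrix_gt0.
by rewrite -scalemxAr mulmxDl -!scalemxAl.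
Qed.

Lemma cone_form (c b b' : R) (V V' : 'rV[R]_m) (G : 'M[R]_m) :
  (row_mx b%:M V *m block_mx s%:M 0 0 (c *: G) *m (row_mx b'%:M V')^T) 0 0 =
  s * b * b' + c * (V *m G *m V'^T) 0 0.
Proof.
rewrite mul_row_block tr_row_mx mul_row_col !mulmx0 addr0 add0r tr_scalar_mx.
rewrite -!scalar_mxM -scalemxAr -scalemxAl.
have lin (A B : 'M[R]_1) : (A + c *: B) 0 0 = A 0 0 + c * B 0 0 by rewrite !mxE.
by rewrite lin mxE eqxx mulr1n (mulrC b).
Qed.

(** Each gradient carries an inverse metric factor and the metric cancels one of the two, leaving 1
    / s radially and t^-2 tangentially. *)
Lemma inner_cone h1 h2 w1 w2 f k1 k2 v1 v2 g y d1 d2 e1 e2 :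
  separated_sum h1 h2 w1 w2 f -> smooth_in_chart w1 -> smooth_in_chart w2 ->
  separated_sum k1 k2 v1 v2 g -> smooth_in_chart v1 -> smooth_in_chart v2 ->
  cone_dom y ->
  let t := lsubmx y 0 0 in let x := rsubmx y in
  let ip w v := inner a (gradient a w) (gradient a v) x in
  let p := chart_inv a x in
  is_derive t 1 h1 d1 -> is_derive t 1 h2 d2 ->
  is_derive t 1 k1 e1 -> is_derive t 1 k2 e2 ->
  inner (M := cone M s) a (gradient (M := cone M s) a f) (gradient (M := cone M s) a g) y =
  s^-1 * (d1 * w1 p + d2 * w2 p) * (e1 * v1 p + e2 * v2 p) +
  t ^- 2 * (h1 t * (k1 t * ip w1 v1 + k2 t * ip w1 v2) +
            h2 t * (k1 t * ip w2 v1 + k2 t * ip w2 v2)).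
Proof.
move=> hf sw1 sw2 hg sv1 sv2 Uy /= dh1 dh2 dk1 dk2; have [t0 _] := Uy.
rewrite /inner (gradient_cone hf sw1 sw2 Uy dh1 dh2).
rewrite (gradient_cone hg sv1 sv2 Uy dk1 dk2) [gmatrix _ _]/= cone_form.
rewrite bilinear_form_lincomb; congr (_ + _).
  by rewrite mulVKf ?gt_eqF// mulrCA mulrA.
by rewrite mulrA mulrCA divff ?mulr1// gt_eqF ?exprn_gt0.
Qed.

(** Radially, t^-m (t^m h')' = h'' + m h' / t; tangentially, t is a constant and the Laplacian of M
    appears with the factor t^-2. The first derivatives are given for all t > 0 because they are
    differentiated again. *)
Lemma laplacianR_cone (h1 h2 h1' h2' : R -> R) w1 w2 f y (d1 d2 : R) :
  separated_sum h1 h2 w1 w2 f -> smooth_in_chart w1 -> smooth_in_chart w2 ->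
  cone_dom y ->
  (forall t : R, 0 < t -> is_derive t 1 h1 (h1' t)) ->
  (forall t : R, 0 < t -> is_derive t 1 h2 (h2' t)) ->
  let t := lsubmx y 0 0 in let x := rsubmx y in let p := chart_inv a x in
  is_derive t 1 h1' d1 -> is_derive t 1 h2' d2 ->
  laplacianR (M := cone M s) a f y =
  s^-1 * ((d1 + m%:R * h1' t / t) * w1 p + (d2 + m%:R * h2' t / t) * w2 p) +
  t ^- 2 * (h1 t * laplacianR a w1 x + h2 t * laplacianR a w2 x).
Proof.
move=> hf sw1 sw2 Uy dh1 dh2 t x p dh1' dh2'; have [t0 ax] := Uy.
rewrite -/t in t0; rewrite -/x in ax.
(* The divergence differentiates the gradient, so its formula is recorded on all of [cone_dom]. *)
have gradE z : cone_dom z -> gradient (M := cone M s) a f z = _ :=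
  fun Uz => gradient_cone hf sw1 sw2 Uz (dh1 _ Uz.1) (dh2 _ Uz.1).
have scalE (c : R) : (c%:M : 'M[R]_1) 0 0 = c by rewrite mxE eqxx.
have lincE (q c1 c2 : R) (A B : 'rV[R]_m) i :
    (q *: (c1 *: A + c2 *: B)) 0 i = q * (c1 * A 0 i + c2 * B 0 i) by rewrite !mxE.
pose V w i z := vol_density a z * gradient a w z 0 i.
pose S w := \sum_i partial i (V w i) x.
have lapE w : laplacianR a w x = (vol_density a x)^-1 * S w by [].
rewrite !lapE [LHS]/laplacianR [LHS]/divergence big_split_ord /= big_ord1 vol_density_cone//.
(* Radial component, arranged as a constant in u times u^m times a derivative, the shape expected by
   [derive_expM]. *)
rewrite (partial_cone_lshift (fun (u : R) z => Num.sqrt s * vol_density a z / s * u ^+ m *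
  (h1' u * w1 (chart_inv a z) + h2' u * w2 (chart_inv a z))) _ Uy); last first.
  by move=> z Uz; rewrite vol_density_cone// gradE// row_mxEl scalE; ring.
rewrite -/t -/x -/p (derive_expM _ _ (is_derive_lincomb (w1 p) (w2 p) dh1' dh2')); last first.
  by rewrite gt_eqF.
(* Tangential components: the radial factors come out as constants and leave the sums in the
   Laplacian of M. *)
rewrite (_ : \sum_(i < m) _ = (Num.sqrt s * t ^+ m * t ^- 2 * h1 t) * S w1 +
  (Num.sqrt s * t ^+ m * t ^- 2 * h2 t) * S w2); last first.
  rewrite /S -sum_lincomb; apply: eq_bigr => i _.
  rewrite (partial_cone_rshift (fun u z =>
    (Num.sqrt s * u ^+ m * u ^- 2 * h1 u) * V w1 i z +
    (Num.sqrt s * u ^+ m * u ^- 2 * h2 u) * V w2 i z) _ _ Uy).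
    by rewrite partial_lincomb //; exact: differentiable_vol_gradient.
  by move=> z Uz; rewrite vol_density_cone// gradE// row_mxEr lincE /V; ring.
have S0 : Num.sqrt s != 0 by rewrite gt_eqF// sqrtr_gt0.
have v0 : vol_density a x != 0 by rewrite gt_eqF// vol_density_gt0.
have T0 : t != 0 by rewrite gt_eqF.
have s0 : s != 0 by rewrite gt_eqF.
move: (S w1) (S w2) (vol_density a x) v0 => S1 S2 v v0.
move: (w1 p) (w2 p) (h1 t) (h2 t) (h1' t) (h2' t) => w1p w2p h1t h2t h1't h2't.
move: (Num.sqrt s) S0 t T0 {t0 dh1' dh2'} => r S0 t T0.
by field; rewrite v0 T0 s0 expf_neq0.
Qed.

End ConeOperators.

(** * Complex powers of a positive real variable *)

Section ComplexPower.
Context {R : realType}.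
Implicit Types (t : R) (k d : R[i]).

(** The exponential is positive, and cos and sin cannot both vanish. This allows the power of t to
    be cancelled in the theorem. *)
Lemma cpow_neq0 t d : cpow t d != 0.
Proof.
rewrite /cpow mulf_neq0//.
  by rewrite eq_complex /= negb_and gt_eqF ?expR_gt0.
rewrite eq_complex /= negb_and; apply: contraT.
rewrite negb_or !negbK => /andP[/eqP c0 /eqP s0].
by have := cos2Dsin2 (complex.Im d * ln t); rewrite c0 s0 expr0n addr0 => /eqP; rewrite eq_sym oner_eq0.
Qed.

Lemma expR_predM (al t : R) : 0 < t -> expR ((al - 1) * ln t) = expR (al * ln t) / t.
Proof. by move=> t0; rewrite mulrBl mul1r expRB lnK. Qed.

(** Used to bring different powers to a common one, leaving factors rational in t. *)
Lemma cpow_predE t d : 0 < t -> cpow t d = t%:C * cpow t (d - 1).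
Proof.
move=> t0; case: d => al be; rewrite /cpow /= subr0 mulrA -rmorphM /=.
by rewrite expR_predM// mulrCA divff ?mulr1 ?gt_eqF.
Qed.

(** The complex factor [k] closes the family under differentiation: second derivatives come from the
    same lemma with [k * d] and [d - 1]. *)
Lemma is_derive_Re_cpow k d t : 0 < t ->
  is_derive t 1 (fun u => complex.Re (k * cpow u d)) (complex.Re (k * d * cpow t (d - 1))).
Proof.
move=> t0; case: k => a b; case: d => al be.
have dl (c : R) : is_derive t 1 (fun u => c * ln u) (c * t^-1).
  exact: (is_deriveZ c (is_derive1_ln t0)).
have scaleE (u v : R) : u *: v = u * v by [].
have dE := is_derive1_comp (is_derive_expR _) (dl al).
have dC := is_derive1_comp (is_derive_cos _) (dl be).
have dS := is_derive1_comp (is_derive_sin _) (dl be).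
have D := is_deriveM dE (is_deriveB (is_deriveZ a dC) (is_deriveZ b dS)).
have -> : (fun u => complex.Re ((a +i* b) * cpow u (al +i* be))) =
   (expR \o (fun u => al * ln u)) * (a *: (cos \o (fun u => be * ln u)) - b *: (sin \o (fun u => be * ln u))).
  apply/funext => u; rewrite /cpow /= !fctE /= !scaleE. ring.
apply: is_derive_eq.
rewrite !fctE /= !scaleE /cpow /= subr0 expR_predM//.
by ring.
Qed.

End ComplexPower.

(** * Homogeneous complex functions on the cone and their slices *)

Section ConeComplex.
Context {R : realType} {m : nat} {M : charted_metric R m} {s : R}.
Hypothesis hM : riemannian_manifold M.
Hypothesis hs : 0 < s.
Variables (d : R[i]) (a : chart M).

(** Convertible to the restrictions that form the family on [M] in the theorem. *)
Definition slice (phi : cone M s -> R[i]) (x : M) : R[i] := phi (one_pos R, x).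

Lemma smooth_slice phi : smooth_fun phi -> smooth_fun (slice phi).
Proof.
move=> sphi b.
have im1 x : chart_im b x -> @chart_im _ _ (cone M s) b (row_mx 1%:M x).
  by move=> bx; rewrite cone_im /= row_mxKl row_mxKr mxE eqxx ltr01.
have invE x : @chart_inv _ _ (cone M s) b (row_mx 1%:M x) = (one_pos R, chart_inv b x).
  by rewrite /= row_mxKl row_mxKr mxE eqxx (insubd_posRK _ (one_pos R)).
have [sR sI] := sphi b; split=> k.
  have := Ck_row_mx k 1 _ _ _ im1 (sR k).
  by congr (Ck k _ _); apply/funext => x; rewrite invE.
have := Ck_row_mx k 1 _ _ _ im1 (sI k).
by congr (Ck k _ _); apply/funext => x; rewrite invE.
Qed.

(** With c = t^d and p the slice value, p = Re p + i Im p gives Re(k c p) = Re(k c) Re p + Re(k i c)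
    Im p. *)
Lemma separated_homogeneous k phi : homogeneous d phi ->
  separated_sum (fun t => complex.Re (k * cpow t d)) (fun t => complex.Re (k * 'i * cpow t d))
    (fun x => complex.Re (slice phi x)) (fun x => complex.Im (slice phi x))
    (fun q => complex.Re (k * phi q)).
Proof.
move=> hphi t x; rewrite hphi -/(slice phi x).
case: k (cpow _ _) (slice phi x) => [k1 k2] [c1 c2] [p1 p2] /=; ring.
Qed.

(** Turns imaginary parts into the case k = -i, so that one computation of Re(k phi) serves both
    parts. *)
Lemma ImE (z : R[i]) : complex.Im z = complex.Re (- 'i * z).
Proof. by case: z => x y /=; ring. Qed.

Lemma lsub_cone_map (t : posR R) x :
  lsubmx (chart_map (c := cone M s) a (t, x)) 0 0 = \val t.
Proof. by rewrite /= row_mxKl mxE eqxx. Qed.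

Lemma rsub_cone_map (t : posR R) x :
  rsubmx (chart_map (c := cone M s) a (t, x)) = chart_map a x.
Proof. by rewrite /= row_mxKr. Qed.

Lemma cone_dom_map (t : posR R) x :
  chart_dom a x -> cone_dom a (chart_map (c := cone M s) a (t, x)).
Proof.
move=> ax; split; first by rewrite lsub_cone_map posR_gt0.
by rewrite rsub_cone_map; exists x.
Qed.

(** The radial terms add up to (d (d - 1) + m d) / s = d (m + d - 1) / s, with t^(d-2) as common
    factor. *)
Lemma laplacianR_homogeneous k phi (t : posR R) x : smooth_fun phi -> homogeneous d phi ->
  chart_dom a x ->
  laplacianR (M := cone M s) a (fun q => complex.Re (k * phi q))
    (chart_map (c := cone M s) a (t, x)) =
  complex.Re (k * (cpow (\val t) (d - 1 - 1) *
    (d * (m%:R + d - 1) / s%:C * slice phi x + laplacian a (slice phi) x))).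
Proof.
move=> sphi hphi ax; have t0 := posR_gt0 t.
have [sR sI] := smooth_slice _ sphi a.
have D (k' e : R[i]) (u : R) : 0 < u -> is_derive u 1 _ _ := is_derive_Re_cpow k' e u.
have := laplacianR_cone hM hs a _ _ _ _ _ _ _ _ _ _ (separated_homogeneous k _ hphi) sR sI
  (cone_dom_map t x ax)   (D k d) (D (k * 'i) d).
rewrite lsub_cone_map rsub_cone_map => /(_ _ _ (D (k * d) (d - 1) _ t0) (D (k * 'i * d) (d - 1) _ t0)) ->.
(* Lowering twice gives t^d = t^2 t^(d-2), which absorbs the t^-2 before the Laplacian of M. *)
rewrite (chart_mapK hM.1 ax) (cpow_predE _ d t0) (cpow_predE _ (d - 1) t0) /laplacian.
move: (laplacianR a _ _) (laplacianR a _ _) => lR lI.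
have -> : (m%:R : R[i]) = m%:R%:C by rewrite rmorph_nat.
have -> : (s%:C)^-1 = s^-1%:C by rewrite fmorphV.
case: (cpow _ _) (slice phi x) k => [c1 c2] [p1 p2] [k1 k2].
move: (\val t) (m%:R : R) t0 => {}t n t0.
case: (d) => [al be] /=; field.
by rewrite !gt_eqF.
Qed.

(** Radial derivatives contribute d t^(d-1) from each argument; tangentially, t^d = t t^(d-1) in
    each argument cancels t^-2. *)
Lemma kappa_homogeneous phi psi (t : posR R) x :
  smooth_fun phi -> homogeneous d phi -> smooth_fun psi -> homogeneous d psi ->
  chart_dom a x ->
  kappa (M := cone M s) a phi psi (t, x) =
  cpow (\val t) (d - 1) ^+ 2 *
    (d ^+ 2 / s%:C * slice phi x * slice psi x + kappa a (slice phi) (slice psi) x).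
Proof.
move=> sphi hphi spsi hpsi ax; have t0 := posR_gt0 t.
have [pR pI] := smooth_slice _ sphi a; have [qR qI] := smooth_slice _ spsi a.
have ip k l := inner_cone hM hs a _ _ _ _ _ _ _ _ _ _ _ _ _ _ _
  (separated_homogeneous k _ hphi) pR pI (separated_homogeneous l _ hpsi) qR qI (cone_dom_map t x ax).
have D (k : R[i]) : is_derive (\val t) 1 _ _ := is_derive_Re_cpow k d _ t0.
rewrite lsub_cone_map rsub_cone_map in ip.
have ReE : (fun q => complex.Re (phi q)) = (fun q => complex.Re (1 * phi q)).
  by apply/funext => q; rewrite mul1r.
have ReE' : (fun q => complex.Re (psi q)) = (fun q => complex.Re (1 * psi q)).
  by apply/funext => q; rewrite mul1r.
have ImE1 : (fun q => complex.Im (phi q)) = (fun q => complex.Re (- 'i * phi q)).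
  by apply/funext => q; rewrite ImE.
have ImE2 : (fun q => complex.Im (psi q)) = (fun q => complex.Re (- 'i * psi q)).
  by apply/funext => q; rewrite ImE.
rewrite /kappa ReE ReE' ImE1 ImE2.
(* The four real pairings in [kappa] are the cases of [ip] with k and l in {1, -i}. *)
do 4!rewrite (ip _ _ _ _ _ _ (D _) (D _) (D _) (D _)).
rewrite !(chart_mapK hM.1 ax) (cpow_predE _ d t0).
move: (inner a (gradient a (fun q => complex.Re (slice phi q)))
  (gradient a (fun q => complex.Re (slice psi q))) _) => i11.
move: (inner a (gradient a (fun q => complex.Re (slice phi q)))
  (gradient a (fun q => complex.Im (slice psi q))) _) => i12.
move: (inner a (gradient a (fun q => complex.Im (slice phi q)))
  (gradient a (fun q => complex.Re (slice psi q))) _) => i21.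
move: (inner a (gradient a (fun q => complex.Im (slice phi q)))
  (gradient a (fun q => complex.Im (slice psi q))) _) => i22.
have -> : (s%:C)^-1 = s^-1%:C by rewrite fmorphV.
case: (cpow _ _) (slice phi x) (slice psi x) => [c1 c2] [p1 p2] [q1 q2].
move: (\val t) t0 => {D ip}t t0; rewrite !expr2.
by case: (d) => [al be] /=; congr (_ +i* _); field; rewrite !gt_eqF.
Qed.

Lemma laplacian_homogeneous phi (t : posR R) x : smooth_fun phi -> homogeneous d phi ->
  chart_dom a x ->
  laplacian (M := cone M s) a phi (t, x) =
  cpow (\val t) (d - 1 - 1) *
    (d * (m%:R + d - 1) / s%:C * slice phi x + laplacian a (slice phi) x).
Proof.
move=> sphi hphi ax; rewrite {1}/laplacian.
have -> : (fun q => complex.Re (phi q)) = (fun q => complex.Re (1 * phi q)).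
  by apply/funext => q; rewrite mul1r.
have -> : (fun q => complex.Im (phi q)) = (fun q => complex.Re (- 'i * phi q)).
  by apply/funext => q; rewrite ImE.
rewrite !laplacianR_homogeneous// mul1r -ImE.
by case: (_ * (_ + _)).
Qed.

End ConeComplex.

Theorem corollary4p4 (R : realType) (m : nat) (hm : (2 <= m)%N)
  (M : charted_metric R m) (hM : riemannian_manifold M)
  (s : R) (hs : 0 < s) (d : R[i]) (F : set (cone M s -> R[i]))
  (Fsmooth : forall phi, F phi -> smooth_fun phi)
  (Fhom : forall phi, F phi -> homogeneous d phi) :
  eigenfamily 0 0 F <->
  eigenfamily (- (d * (m%:R + d - 1) / s%:C)) (- (d ^+ 2 / s%:C))
    [set (fun x : M => phi (one_pos R, x)) | phi in F].
Proof.
split=> [[_ lapF kapF]|[_ lapF kapF]]; split.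
- by move=> _ [phi Fphi <-]; exact/smooth_slice/Fsmooth.
(* The eigenvalue equation says that the bracket in [laplacian_homogeneous] vanishes; at t = 1 its
   nonzero prefactor is cancelled. *)
- move=> _ [phi Fphi <-] a p ap; apply/eqP; rewrite mulNr -addr_eq0 addrC; apply/eqP.
  apply: (mulfI (cpow_neq0 (\val (one_pos R)) (d - 1 - 1))).
  have <- := laplacian_homogeneous hM hs d a phi (one_pos R) p (Fsmooth _ Fphi) (Fhom _ Fphi) ap.
  by rewrite lapF// mul0r mulr0.
- move=> _ _ [phi Fphi <-] [psi Fpsi <-] a p ap.
  apply/eqP; rewrite !mulNr -addr_eq0 addrC; apply/eqP.
  apply: (mulfI (expf_neq0 2 (cpow_neq0 (\val (one_pos R)) (d - 1)))).
  have <- := kappa_homogeneous hM hs d a phi psi (one_pos R) p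
    (Fsmooth _ Fphi) (Fhom _ Fphi) (Fsmooth _ Fpsi) (Fhom _ Fpsi) ap.
  by rewrite kapF// !mul0r mulr0.
- exact: Fsmooth.
(* Conversely, the equation on M at x annihilates the bracket, hence the cone Laplacian at (t, x)
   for every t. *)
- move=> phi Fphi a [t x] ax.
  rewrite (laplacian_homogeneous hM hs d)//; [|exact: Fsmooth|exact: Fhom].
  rewrite (lapF (slice phi))//; last by exists phi.
  by rewrite mulNr subrr mulr0 mul0r.
- move=> phi psi Fphi Fpsi a [t x] ax.
  rewrite (kappa_homogeneous hM hs d)//; try by [exact: Fsmooth|exact: Fhom].
  rewrite (kapF (slice phi) (slice psi))//; [|by exists phi|by exists psi].
  by rewrite !mulNr subrr mulr0 !mul0r.
Qed.
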